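(* Suppose that $u_0\in H^{\frac{s\nu}{2}}(\mathbb G)\cup\mathcal E'(\mathbb G)$. Then the very weak solution to the Cauchy problem $$i\,u_t(t,x)+\mathcal R^s u(t,x)+p(x)u(t,x)=0,\quad (t,x)\in[0,T]\times\mathbb G,\qquad u(0,x)=u_0(x),\quad x\in\mathbb G,$$ is $(L^\infty(\mathbb G),L^\infty(\mathbb G))$-unique. That is: for all $L^\infty(\mathbb G)$-moderate nets $(p_\epsilon)_\epsilon$, $(\tilde p_\epsilon)_\epsilon$ with $p_\epsilon\ge0$, $\tilde p_\epsilon\ge0$ such that $(p_\epsilon-\tilde p_\epsilon)_\epsilon$ is $L^\infty(\mathbb G)$-negligible, and for all $H^{\frac{s\nu}{2}}(\mathbb G)$-moderate regularisations $(u_{0,\epsilon})_\epsilon$, $(\tilde u_{0,\epsilon})_\epsilon$ of $u_0$ such that $(u_{0,\epsilon}-\tilde u_{0,\epsilon})_\epsilon$ is $H^{\frac{s\nu}{2}}(\mathbb G)$-negligible, the families of solutions $(u_\epsilon)_\epsilon$, $(\tilde u_\epsilon)_\epsilon$ in $C([0,T];H^{\frac{s\nu}{2}}(\mathbb G))$ of $$i\partial_tu_\epsilon+\mathcal R^su_\epsilon+p_\epsilon u_\epsilon=0,\ u_\epsilon(0,\cdot)=u_{0,\epsilon}\qquad\text{and}\qquad i\partial_t\tilde u_\epsilon+\mathcal R^s\tilde u_\epsilon+\tilde p_\epsilon\tilde u_\epsilon=0,\ \tilde u_\epsilon(0,\cdot)=\tilde u_{0,\epsilon}$$ on $[0,T]\times\mathbb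 G$ satisfy: for every $N\in\mathbb N$ there is $C_N>0$ with $$\|u_\epsilon(t,\cdot)-\tilde u_\epsilon(t,\cdot)\|_{L^2(\mathbb G)}\le C_N\epsilon^N\quad\text{for all }t\in[0,T],\ \epsilon\in(0,1].$$
   Context: $\mathbb G$ is a graded Lie group: a connected simply connected Lie group whose Lie algebra decomposes as $\mathfrak g=\bigoplus_{i\ge1}\mathfrak g_i$ (all but finitely many $\mathfrak g_i$ zero) with $[\mathfrak g_i,\mathfrak g_j]\subset\mathfrak g_{i+j}$. Fix a basis $X_1,\dots,X_n$ of $\mathfrak g$ adapted to the gradation and identify $\mathbb G$ with $\mathbb R^n$ through the exponential map. The dilations are the group automorphisms $D_r(x)=(r^{\nu_1}x_1,\dots,r^{\nu_n}x_n)$, $r>0$, where $\nu_j=i$ if $X_j\in\mathfrak g_i$; the homogeneous dimension is $Q=\nu_1+\dots+\nu_n$. $L^q(\mathbb G)$ is taken with respect to the Haar measure $dx$; $\mathcal E'(\mathbb G)$ is the space of compactly supported distributions. $\mathcal R$ is a fixed positive Rockland operator on $\mathbb G$ of homogeneous degree $\nu>0$: a left-invariant differential operator, homogeneous of degree $\nu$ for the dilations, such that for every non-trivial irreducible unitary representation $\pi$ of $\mathbb G$ the operator $\pi(\mathcal R)$ is injective on the smooth vectors $\mathcal H_\pi^\infty$ (equivalently, $\mathcal R$ is hypoelliptic), and which is formally self-adjoint ($\mathcal R=\mathcal R^*$) with $\int_{\mathbb G}\mathcal Rf(x)\overline{f(x)}\,dx\ge0$ for all $f\in C_c^\infty(\mathbb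 G)$. We also write $\mathcal R$ for its self-adjoint extension on $L^2(\mathbb G)$; real powers are defined by the spectral theorem. Fix $s>0$ and $T>0$. $H^{\frac{s\nu}{2}}(\mathbb G)$ is the domain of $\mathcal R^{s/2}$ in $L^2(\mathbb G)$, with norm $\|f\|_{H^{\frac{s\nu}{2}}(\mathbb G)}=\|\mathcal R^{s/2}f\|_{L^2(\mathbb G)}+\|f\|_{L^2(\mathbb G)}$. Regularisation: a Friedrichs mollifier is $\psi\in C_c^\infty(\mathbb G)$ with $\int_{\mathbb G}\psi\,dx=1$; $\psi_\epsilon(x)=\epsilon^{-Q}\psi(D_{\epsilon^{-1}}(x))$, $\epsilon\in(0,1]$. A regularisation of a distribution $v$ is a net $v_\epsilon=v*\psi_\epsilon$, where $(f*g)(x)=\int_{\mathbb G}f(y)g(y^{-1}x)\,dy$. For a normed space $X$ of functions on $\mathbb G$, a net $(f_\epsilon)_{\epsilon\in(0,1]}$ in $X$ is $X$-moderate if there are $N\in\mathbb N$, $C>0$ with $\|f_\epsilon\|_X\le C\epsilon^{-N}$ for all $\epsilon\in(0,1]$. For a normed space $Y$ of functions, a net $(f_\epsilon-\tilde f_\epsilon)_\epsilon$ is $Y$-negligible if for every $k\in\mathbb N$ there is $C_k>0$ with $\|f_\epsilon-\tilde f_\epsilon\|_Y\le C_k\epsilon^k$ for all $\epsilon\in(0,1]$. Solutions are understood in the weak (form) sense: for every $\varphi\in H^{\frac{s\nu}{2}}(\mathbb G)$, $t\mapsto\langle u_\epsilon(t),\varphi\rangle_{L^2}$ is $C^1$ with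 $i\frac{d}{dt}\langle u_\epsilon(t),\varphi\rangle_{L^2}+\langle\mathcal R^{s/2}u_\epsilon(t),\mathcal R^{s/2}\varphi\rangle_{L^2}+\int_{\mathbb G}p_\epsilon u_\epsilon(t)\overline\varphi\,dx=0$ (likewise for $\tilde u_\epsilon$). *)

(* Defs.v *)
From HB Require Import structures.
From mathcomp Require Import all_boot all_order all_algebra complex.
From mathcomp Require Import all_classical all_reals all_analysis.

Set Implicit Arguments.
Unset Strict Implicit.
Unset Printing Implicit Defensive.

Import Order.TTheory GRing.Theory Num.Theory numFieldNormedType.Exports.

Local Open Scope classical_set_scope.
Local Open Scope ring_scope.
Local Open Scope complex_scope.

(* Calculus for functions of real variables with values in a complex normed
   space; complex-valued functions are the case V := R[i]^o. *)
Section Calculus.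
Context {R : realType} {V : normedModType R[i]}.

Definition diffquot (F : R -> V) (t h : R) : V :=
  (h%:C)^-1 *: (F (t + h) - F t).

Definition rderivable (F : R -> V) (t : R) : Prop :=
  cvg (diffquot F t h @[h --> (0 : R)^']).

Definition rderive (F : R -> V) (t : R) : V :=
  lim (diffquot F t h @[h --> (0 : R)^']).

Definition line {m : nat} (x : 'rV[R]_m) (j : 'I_m) (F : 'rV[R]_m -> V)
  (t : R) : V := F (x + t *: delta_mx 0 j).

Definition partial {m : nat} (j : 'I_m) (F : 'rV[R]_m -> V)
  (x : 'rV[R]_m) : V := rderive (line x j F) 0.

Fixpoint classC {m : nat} (k : nat) (F : 'rV[R]_m -> V) : Prop :=
  continuous F /\
  if k is k'.+1 then
    forall j : 'I_m,
      (forall x, rderivable (line x j F) 0) /\ classC k' (partial j F)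
  else True.

Definition smooth {m : nat} (F : 'rV[R]_m -> V) : Prop :=
  forall k, classC k F.

Definition partials {m : nat} (w : seq 'I_m) (F : 'rV[R]_m -> V) :
  'rV[R]_m -> V := foldr partial F w.

End Calculus.

Definition csmooth {R : realType} {m : nat} (f : 'rV[R]_m -> R[i]) : Prop :=
  smooth (f : 'rV[R]_m -> R[i]^o).

Definition test_fun {R : realType} {m : nat} (f : 'rV[R]_m -> R[i]) : Prop :=
  csmooth f /\
  exists K : set 'rV[R]_m, compact K /\ forall x, ~ K x -> f x = 0.

(* With e_j the j-th unit vector, [lie_deriv mul j f] is X_j f for the
   left-invariant field X_j whose one-parameter group is t |-> t e_j. *)
Definition lie_deriv {R : realType} {n : nat}
    (mul : 'rV[R]_n -> 'rV[R]_n -> 'rV[R]_n) (j : 'I_n)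
    (f : 'rV[R]_n -> R[i]) (x : 'rV[R]_n) : R[i] :=
  rderive ((fun t => f (mul x (t *: delta_mx 0 j))) : R -> R[i]^o) 0.

(* A graded Lie group in exponential coordinates: a Lie group with manifold
   R^n in which every line t |-> t x is a one-parameter subgroup (so exp is
   the identity map, and the inverse of x is - x), whose Lie algebra of
   left-invariant vector fields has the basis X_1, ..., X_n adapted to a
   gradation, X_j having weight [weight j]. *)
Record graded_group (R : realType) (n : nat) := GradedGroup {
  gmul : 'rV[R]_n -> 'rV[R]_n -> 'rV[R]_n;
  gmulA : forall x y z, gmul x (gmul y z) = gmul (gmul x y) z;
  gmul0x : forall x, gmul 0 x = x;
  gmulx0 : forall x, gmul x 0 = x;
  gmul_smooth : forall j : 'I_n,
    csmooth (fun z : 'rV[R]_(n + n) => (gmul (lsubmx z) (rsubmx z) 0 j)%:C);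
  gmul_exp : forall x (a b : R), gmul (a *: x) (b *: x) = (a + b) *: x;
  weight : 'I_n -> nat;
  weight_gt0 : forall j, (0 < weight j)%N;
  gbracket : forall i j : 'I_n, exists c : 'I_n -> R,
    (forall k, c k != 0 -> weight k = (weight i + weight j)%N) /\
    forall f, csmooth f -> forall x,
      lie_deriv gmul i (lie_deriv gmul j f) x
        - lie_deriv gmul j (lie_deriv gmul i f) x
      = \sum_(k < n) (c k)%:C * lie_deriv gmul k f x
}.

Definition dil {R : realType} {n : nat} (G : graded_group R n) (r : R)
  (x : 'rV[R]_n) : 'rV[R]_n := \row_j (r ^+ weight G j * x 0 j).

Definition hom_dim {R : realType} {n : nat} (G : graded_group R n) : nat :=
  (\sum_(j < n) weight G j)%N.

Definition borelV (R : realType) (n : nat) :=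
  g_sigma_algebraType (@open 'rV[R]_n).

(* Haar measures are unique up to a positive factor; no normalisation is
   fixed. *)
Definition haar_measure {R : realType} {n : nat} (G : graded_group R n)
    (mu : {measure set (borelV R n) -> \bar R}) : Prop :=
  [/\ forall (x : 'rV[R]_n) (B : set (borelV R n)), measurable B ->
        mu ((gmul G x : borelV R n -> borelV R n) @^-1` B) = mu B,
      forall K : set 'rV[R]_n, compact K -> (mu K < +oo)%E
    & forall B : set 'rV[R]_n, open B -> B !=set0 -> (0 < mu B)%E].

(* Elements of L^2 are represented by functions; equality in L^2 is equality
   almost everywhere. *)
Section L2.
Context {d : measure_display} {X : measurableType d} {R : realType}.
Variable mu : {measure set X -> \bar R}.

Definition cintegral (f : X -> R[i]) : R[i] :=
  (\int[mu]_x complex.Re (f x)) +i* (\int[mu]_x complex.Im (f x)).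

Definition L2 (f : X -> R[i]) : Prop :=
  (fun x => complex.Re (f x)) \in Lfun mu 2%:E /\
  (fun x => complex.Im (f x)) \in Lfun mu 2%:E.

Definition inner (f g : X -> R[i]) : R[i] :=
  cintegral (fun x => f x * (g x)^*%C).

Definition L2norm (f : X -> R[i]) : R :=
  Num.sqrt (\int[mu]_x (complex.Re (f x) ^+ 2 + complex.Im (f x) ^+ 2)).

Definition aeq (f g : X -> R[i]) : Prop := {ae mu, forall x, f x = g x}.

(* A possibly unbounded operator; only the values of [op_act] on [op_dom] are
   meaningful. *)
Record operator := Operator {
  op_dom : set (X -> R[i]);
  op_act : (X -> R[i]) -> X -> R[i]
}.

Definition graph_norm (A : operator) (f : X -> R[i]) : R :=
  L2norm (op_act A f) + L2norm f.

Definition linear_op (A : operator) : Prop :=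
  [/\ forall f, op_dom A f -> L2 f /\ L2 (op_act A f),
      op_dom A (fun=> 0)
    & forall (a : R[i]) f g, op_dom A f -> op_dom A g ->
        op_dom A (fun x => a * f x + g x) /\
        aeq (op_act A (fun x => a * f x + g x))
            (fun x => a * op_act A f x + op_act A g x)].

Definition densely_defined (A : operator) : Prop :=
  forall f, L2 f -> forall e : R, 0 < e ->
    exists2 g, op_dom A g & L2norm (f \- g) < e.

Definition adjoint_graph (A : operator) (f h : X -> R[i]) : Prop :=
  forall g, op_dom A g -> inner (op_act A g) f = inner g h.

Definition self_adjoint (A : operator) : Prop :=
  [/\ linear_op A, densely_defined A
    & forall f h, L2 f -> L2 h ->
        (adjoint_graph A f h <-> op_dom A f /\ aeq (op_act A f) h)].

End L2.

Definition unitary_map {R : realType} {d d' : measure_display}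
    {X : measurableType d} {Y : measurableType d'}
    (mu : {measure set X -> \bar R}) (m : {measure set Y -> \bar R})
    (U : (X -> R[i]) -> Y -> R[i]) : Prop :=
  [/\ forall f, L2 mu f -> L2 m (U f),
      forall (a : R[i]) f g, L2 mu f -> L2 mu g ->
        aeq m (U (fun x => a * f x + g x)) (fun y => a * U f y + U g y),
      forall f g, L2 mu f -> L2 mu g -> inner m (U f) (U g) = inner mu f g
    & forall k, L2 m k -> exists2 f, L2 mu f & aeq m (U f) k].

(* B is carried by the unitary U to the maximal operator of multiplication
   by the real function sigma. *)
Definition diagonalizes {R : realType} {d d' : measure_display}
    {X : measurableType d} {Y : measurableType d'}
    (mu : {measure set X -> \bar R}) (m : {measure set Y -> \bar R})
    (U : (X -> R[i]) -> Y -> R[i]) (sigma : Y -> R) (B : @operator _ X R) :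
    Prop :=
  let mult f y := (sigma y)%:C * U f y in
  [/\ unitary_map mu m U,
      forall f, op_dom B f <-> L2 mu f /\ L2 m (mult f)
    & forall f, op_dom B f ->
        L2 mu (op_act B f) /\ aeq m (U (op_act B f)) (mult f)].

(* A = B^a for a > 0 and B nonnegative self-adjoint, by the spectral theorem
   in multiplication form: if B is multiplication by sigma >= 0 then B^a is
   multiplication by sigma^a.  By uniqueness of the functional calculus, A
   does not depend on the chosen diagonalisation. *)
Definition real_power {R : realType} {d : measure_display}
    {X : measurableType d} (mu : {measure set X -> \bar R})
    (B : @operator _ X R) (a : R) (A : @operator _ X R) : Prop :=
  exists (d' : measure_display) (Y : measurableType d')
    (m : {sigma_finite_measure set Y -> \bar R})
    (U : (X -> R[i]) -> Y -> R[i]) (sigma : Y -> R),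
    [/\ measurable_fun setT sigma, forall y, 0 <= sigma y,
        diagonalizes mu m U sigma B
      & diagonalizes mu m U (fun y => sigma y `^ a) A].

(* [:: (c_1, w_1); ...] stands for the element c_1 X_{w_1} + ... of the
   complexified universal enveloping algebra, where X_{[:: j_1; ...; j_k]} is
   X_{j_1} ... X_{j_k}; these are the left-invariant differential operators. *)
Definition lidiff_op (R : realType) (n : nat) := seq (R[i] * seq 'I_n).

Definition lidiff_act {R : realType} {n : nat} (G : graded_group R n)
    (P : lidiff_op R n) (f : 'rV[R]_n -> R[i]) (x : 'rV[R]_n) : R[i] :=
  \sum_(cw <- P) cw.1 * foldr (lie_deriv (gmul G)) f cw.2 x.

Definition homogeneous_op {R : realType} {n : nat} (G : graded_group R n)
    (P : lidiff_op R n) (nu : R) : Prop :=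
  forall r : R, 0 < r -> forall f, csmooth f -> forall x,
    lidiff_act G P (f \o dil G r) x
    = (r `^ nu)%:C * lidiff_act G P f (dil G r x).

Section Representations.
Context {R : realType} {n : nat}.
Variables (G : graded_group R n) (H : completeNormedModType R[i]).

Definition hilbert_product (ip : H -> H -> R[i]) : Prop :=
  [/\ forall (a : R[i]) u v w, ip (a *: u + v) w = a * ip u w + ip v w,
      forall u v, ip v u = (ip u v)^*%C
    & forall v, ip v v = `|v| ^+ 2].

Definition unitary_rep (ip : H -> H -> R[i]) (pi : 'rV[R]_n -> H -> H) :
    Prop :=
  [/\ forall x (a : R[i]) u v, pi x (a *: u + v) = a *: pi x u + pi x v,
      forall v, pi 0 v = v,
      forall x y v, pi (gmul G x y) v = pi x (pi y v),
      forall x u v, ip (pi x u) (pi x v) = ip u v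
    & forall v, continuous (pi^~ v)].

Definition irreducible_rep (pi : 'rV[R]_n -> H -> H) : Prop :=
  (exists v : H, v != 0) /\
  forall W : set H, closed W -> W 0 ->
    (forall (a : R[i]) u v, W u -> W v -> W (a *: u + v)) ->
    (forall x v, W v -> W (pi x v)) ->
    W = [set 0] \/ W = setT.

Definition nontrivial_rep (pi : 'rV[R]_n -> H -> H) : Prop :=
  exists x v, pi x v <> v.

Definition smooth_vector (pi : 'rV[R]_n -> H -> H) (v : H) : Prop :=
  smooth (pi^~ v).

Definition dpi (pi : 'rV[R]_n -> H -> H) (j : 'I_n) (v : H) : H :=
  rderive (fun t => pi (t *: delta_mx 0 j) v) 0.

Definition dpi_op (pi : 'rV[R]_n -> H -> H) (P : lidiff_op R n) (v : H) : H :=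
  \sum_(cw <- P) cw.1 *: foldr (dpi pi) v cw.2.

End Representations.

Definition rockland {R : realType} {n : nat} (G : graded_group R n)
    (P : lidiff_op R n) : Prop :=
  forall (H : completeNormedModType R[i]) (ip : H -> H -> R[i])
    (pi : 'rV[R]_n -> H -> H),
    hilbert_product ip -> unitary_rep G ip pi ->
    irreducible_rep pi -> nontrivial_rep pi ->
    forall u v, smooth_vector pi u -> smooth_vector pi v ->
      dpi_op pi P u = dpi_op pi P v -> u = v.

Definition positive_rockland {R : realType} {n : nat} (G : graded_group R n)
    (mu : {measure set (borelV R n) -> \bar R}) (P : lidiff_op R n) (nu : R) :
    Prop :=
  [/\ homogeneous_op G P nu, rockland G P,
      forall f g, test_fun f -> test_fun g ->
        inner mu (lidiff_act G P f) g = inner mu f (lidiff_act G P g)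
    & forall f, test_fun f -> 0 <= inner mu (lidiff_act G P f) f].

(* A positive Rockland operator is essentially self-adjoint on C_c^oo, so it
   has a single self-adjoint extension. *)
Definition sa_extension {R : realType} {n : nat} (G : graded_group R n)
    (mu : {measure set (borelV R n) -> \bar R}) (P : lidiff_op R n)
    (B : @operator _ (borelV R n) R) : Prop :=
  self_adjoint mu B /\
  forall f, test_fun f -> op_dom B f /\ aeq mu (op_act B f) (lidiff_act G P f).

(* A distribution is given by its values on C_c^oo; other values are
   irrelevant. *)
Section Distributions.
Context {R : realType} {n : nat}.
Implicit Types u : ('rV[R]_n -> R[i]) -> R[i].

Definition distribution_on u : Prop :=
  (forall (a : R[i]) f g, test_fun f -> test_fun g ->
     u (fun x => a * f x + g x) = a * u f + u g) /\
  forall K : set 'rV[R]_n, compact K ->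
    exists (C : R) (k : nat), forall f, test_fun f ->
      (forall x, ~ K x -> f x = 0) ->
      forall M : R,
        (forall w : seq 'I_n, (size w <= k)%N -> forall x,
           `|partials w (f : 'rV[R]_n -> R[i]^o) x| <= M%:C) ->
        `|u f| <= (C * M)%:C.

Definition compactly_supported u : Prop :=
  exists K : set 'rV[R]_n, compact K /\
    forall f, test_fun f ->
      (exists B : set 'rV[R]_n,
         [/\ open B, K `<=` B & forall x, B x -> f x = 0]) ->
      u f = 0.

Definition represents (mu : {measure set (borelV R n) -> \bar R})
    (f : borelV R n -> R[i]) u : Prop :=
  forall g, test_fun g -> u g = cintegral mu (fun x => f x * g x).

End Distributions.

Definition mollifier {R : realType} {n : nat}
    (mu : {measure set (borelV R n) -> \bar R}) (psi : 'rV[R]_n -> R[i]) :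
    Prop := test_fun psi /\ cintegral mu psi = 1.

Definition mollify {R : realType} {n : nat} (G : graded_group R n)
    (psi : 'rV[R]_n -> R[i]) (e : R) (x : 'rV[R]_n) : R[i] :=
  (e ^- hom_dim G)%:C * psi (dil G e^-1 x).

(* (v * g)(x) = <v, y |-> g (y^-1 x)>, with y^-1 = - y. *)
Definition conv_distr {R : realType} {n : nat} (G : graded_group R n)
    (v : ('rV[R]_n -> R[i]) -> R[i]) (g : 'rV[R]_n -> R[i]) (x : 'rV[R]_n) :
    R[i] := v (fun y => g (gmul G (- y) x)).

Definition regularisation {R : realType} {n : nat} (G : graded_group R n)
    (mu : {measure set (borelV R n) -> \bar R})
    (v : ('rV[R]_n -> R[i]) -> R[i]) (net : R -> borelV R n -> R[i]) : Prop :=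
  exists psi, mollifier mu psi /\
    forall e : R, 0 < e <= 1 -> forall x,
      net e x = conv_distr G v (mollify G psi e) x.

(* Nets are indexed by e in (0, 1]; a normed space of functions is given by
   its underlying set and its norm. *)
Definition moderate {R : realType} {F : Type} (S : set F) (N : F -> R)
    (net : R -> F) : Prop :=
  (forall e, 0 < e <= 1 -> S (net e)) /\
  exists (k : nat) (C : R), 0 < C /\
    forall e, 0 < e <= 1 -> N (net e) <= C * e ^- k.

Definition negligible_net {R : realType} {F : Type} (N : F -> R)
    (net : R -> F) : Prop :=
  forall k : nat, exists C : R, 0 < C /\
    forall e, 0 < e <= 1 -> N (net e) <= C * e ^+ k.

Definition Linf {R : realType} {d : measure_display} {X : measurableType d}
    (mu : {measure set X -> \bar R}) : set (X -> R) :=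
  [set f | f \in Lfun mu +oo%E].

Definition Linf_norm {R : realType} {d : measure_display}
    {X : measurableType d} (mu : {measure set X -> \bar R}) (f : X -> R) : R :=
  fine ('N[mu]_+oo [EFin \o f])%E.

Definition deriv_within {R : realType} (T : R) (F : R -> R[i]) (t : R)
    (l : R[i]) : Prop :=
  (((r - t)%:C)^-1 * (F r - F t) : R[i]^o) @[r --> within `[0, T] (t^')]
    --> (l : R[i]^o).

(* u is a solution in C([0, T]; H) of i u_t + A^2 u + p u = 0, u(0) = v, in
   the form sense, H being the domain of A with its graph norm. *)
Definition form_solution {R : realType} {d : measure_display}
    {X : measurableType d} (mu : {measure set X -> \bar R})
    (A : @operator _ X R) (T : R) (p : X -> R) (v : X -> R[i])
    (u : R -> X -> R[i]) : Prop :=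
  [/\ forall t, 0 <= t <= T -> op_dom A (u t),
      forall t, 0 <= t <= T ->
        graph_norm mu A (u r \- u t) @[r --> within `[0, T] (nbhs t)]
          --> (0 : R),
      aeq mu (u 0) v
    & forall phi, op_dom A phi -> exists g : R -> R[i],
        {within `[0, T], continuous (g : R -> R[i]^o)} /\
        forall t, 0 <= t <= T ->
          deriv_within T (fun r => inner mu (u r) phi) t (g t) /\
          'i%C * g t + inner mu (op_act A (u t)) (op_act A phi)
            + cintegral mu (fun x => (p x)%:C * u t x * (phi x)^*%C) = 0].

(* Main.v *)
Require Import Defs.
From HB Require Import structures.
From mathcomp Require Import all_boot all_order all_algebra complex.
From mathcomp Require Import all_classical all_reals all_analysis.
From mathcomp Require Import measurable_realfun ess_sup_inf ring lra.
Import Order.TTheory GRing.Theory Num.Theory numFieldNormedType.Exports.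
Local Open Scope classical_set_scope.
Local Open Scope ring_scope.

(** Write [A] for the power [B^(s/2)] and let [u], [u'] be the solutions with
    potentials [p], [p'] and data [v], [v'] at a fixed value of the parameter
    [e].  The proof is an energy estimate that treats the pair [u], [u']
    symmetrically.  Formally,

      d/dt <u, u'> = i <A u, A u'> + i <p u, u'>
                     - i <A u, A u'> - i <p' u, u'> = i <(p - p') u, u'>,

    because the form of [A] is hermitian and the potentials are real.  With
    [u' = u] this says that the L^2 norm of a solution is constant in time.  In
    general it says that [Re <u, u'>] moves with speed at most
    [|p - p'|_oo |v| |v'|].  Expanding the square [|u - u'|^2] gives
    ([solution_stability])

      |u(t) - u'(t)|^2 <= |v - v'|^2 + 2 T |p - p'|_oo |v| |v'|.

    On the right, the differences are smaller than every power of [e] and the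
    norms [|v|], [|v'|] grow at most like a power of [1/e]; choosing the order
    of smallness of [p - p'] large enough proves the claim.

    The formal computation has to be justified, since [u] is differentiable only
    when tested against a fixed vector of the form domain.  In the product rule
    this leaves the term [<u(r) - u(t), u'(r) - u'(t)>], which must be shown to
    be [o(r - t)]; [solution_increment] does so by testing the equation with the
    increment [u(r) - u(t)].

    The operator enters through its form domain: a space of L^2 functions closed
    under differences, mapped to L^2 with a triangle inequality for the norm of
    the values ([form_operator]).  Every operator that is unitarily equivalent
    to multiplication by a measurable function has this property, in particular
    the powers of [B]. *)

(** * Derivatives relative to a closed interval *)

(** Differentiability of [F] at [t] relative to [0, T], with the quotient
    multiplied out: no division by [r - t], so that estimates can be added, and
    the endpoints are covered by the same formula. *)
Definition has_slope {R : realType} (T : R) (F : R -> R) (t l : R) : Prop :=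
  forall e, 0 < e -> exists2 d, 0 < d &
    forall r, 0 <= r <= T -> `|r - t| < d ->
      `|F r - F t - l * (r - t)| <= e * `|r - t|.

Section Slopes.
Set Implicit Arguments.
Unset Strict Implicit.
Context {R : realType}.
Variable T : R.
Implicit Types (F : R -> R) (t l : R).

Lemma normr_Re_le (z : R[i]) : (`|complex.Re z|%:C <= `|z|)%C.
Proof.
by rewrite normc_def lecR -sqrtr_sqr ler_sqrt ?addr_ge0 ?sqr_ge0// lerDl sqr_ge0.
Qed.

Lemma deriv_within_slope_Re (F : R -> R[i]) t (l : R[i]) :
  deriv_within T F t l ->
  has_slope T (fun r => complex.Re (F r)) t (complex.Re l).
Proof.
move=> /cvgrPdist_le H e e0.
have e0' : 0 < (e%:C)%C :> R[i] by rewrite ltcR.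
have := H _ e0'; rewrite near_withinE => -[d /= d0 Hd].
exists d => // r r0T rt.
have [->|rnt] := eqVneq r t; first by rewrite !subrr mulr0 subrr normr0 mulr0.
have := Hd r; rewrite /ball/= distrC => /(_ rt rnt) /=.
rewrite in_itv/= => /(_ r0T) Hr.
have := le_trans (normr_Re_le _) Hr; rewrite lecR => {}Hr.
have rt0 : 0 < `|r - t| by rewrite normr_gt0 subr_eq0.
rewrite -ler_pdivrMr// -normfV -normrM.
apply: le_trans Hr; rewrite -normrN le_eqVlt; apply/orP; left; apply/eqP.
congr (`|_|); rewrite -(fmorphV (real_complex R)).
have rt0' : r - t != 0 by rewrite subr_eq0.
case: l {H Hd} => l1 l2; case: (F r) => a b; case: (F t) => a' b' /=.
by field.
Qed.

Lemma has_slope_derive F t l : 0 < t < T -> has_slope T F t l ->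
  is_derive t 1 F l.
Proof.
move=> /andP[t0 tT] H.
suff C : h^-1 *: ((F \o shift t) (h *: (1:R)) - F t) @[h --> 0^'] --> l.
  apply: DeriveDef; first by apply/cvg_ex; exists l.
  by apply/cvg_lim => //.
apply/cvgrPdist_le => e e0; have [d d0 Hd] := H e e0.
exists (Num.min d (Num.min t (T - t))) => /=.
  by rewrite !lt_min d0 t0 subr_gt0.
move=> h; rewrite /ball/= sub0r normrN !lt_min => /and3P[hd ht hT] h0.
have := Hd (h + t); rewrite addrK => /(_ _ hd) => Hh.
rewrite /GRing.scale/= mulr1.
have h0' : 0 < `|h| by rewrite normr_gt0.
have {}Hh : `|F (h + t) - F t - l * h| <= e * `|h|.
  by apply: Hh; move: ht hT; rewrite !ltr_norml => /andP[? ?] /andP[? ?]; lra.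
rewrite -(ler_pM2r h0'); apply: le_trans Hh; rewrite -normrM.
rewrite -normrN le_eqVlt; apply/orP; left; apply/eqP; congr (`|_|).
by field.
Qed.

Lemma has_slope_continuous F (l : R -> R) :
  (forall t, 0 <= t <= T -> has_slope T F t (l t)) ->
  {within `[0, T], continuous F}.
Proof.
move=> H; apply/subspace_continuousP => t; rewrite /= in_itv/= => tT.
apply/cvgrPdist_le => e e0; have [d d0 Hd] := H t tT _ ltr01.
have k0 : 0 < 1 + `|l t| by rewrite ltr_pwDl.
rewrite near_withinE; exists (Num.min d (e / (1 + `|l t|))) => /=.
  by rewrite lt_min d0 divr_gt0.
move=> r; rewrite /ball/= lt_min distrC => /andP[rd re].
rewrite in_itv/= => rT; have := Hd r rT rd => {}Hd.
rewrite distrC -[F r - F t](subrK (l t * (r - t))).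
rewrite (le_trans (ler_normD _ _))// normrM.
apply: le_trans (lerD Hd (lexx _)) _.
by rewrite -mulrDl mulrC -ler_pdivlMr// ltW.
Qed.

Lemma has_slope_lipschitz_itv F (l : R -> R) (a b M : R) : 0 <= a -> a <= b -> b <= T ->
  (forall t, 0 <= t <= T -> has_slope T F t (l t)) ->
  (forall t, a <= t <= b -> `|l t| <= M) ->
  `|F b - F a| <= M * (b - a).
Proof.
move=> a0 ab bT H HM.
have [||c] := @MVT_segment R F l a b ab.
- move=> x; rewrite in_itv/= => /andP[ax xb]; apply: has_slope_derive.
    by rewrite (le_lt_trans a0 ax) (lt_le_trans xb bT).
  by apply: H; rewrite (le_trans a0 (ltW ax)) (le_trans (ltW xb) bT).
- have sub : `[a, b] `<=` `[0, T] by apply: subset_itv; rewrite bnd_simp.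
  exact: (continuous_subspaceW sub (has_slope_continuous H)).
- rewrite in_itv/= => cab ->; rewrite normrM [`|b - a|]ger0_norm ?subr_ge0//.
  by rewrite ler_wpM2r ?subr_ge0// HM.
Qed.

(** The bound on the slope is asked only at points no farther from [a] than
    [b] is: this is what allows bounds that are known only near [a]. *)
Lemma has_slope_lipschitz F (l : R -> R) (a b M : R) : 0 <= a <= T -> 0 <= b <= T ->
  (forall t, 0 <= t <= T -> has_slope T F t (l t)) ->
  (forall t, 0 <= t <= T -> `|t - a| <= `|b - a| -> `|l t| <= M) ->
  `|F b - F a| <= M * `|b - a|.
Proof.
move=> /andP[a0 aT] /andP[b0 bT] H HM.
have [ab|ba] := leP a b.
  rewrite [`|b - a|]ger0_norm ?subr_ge0//; apply: (has_slope_lipschitz_itv _ _ _ H) => //.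
  move=> t /andP[ta tb]; apply: HM; first by lra.
  by rewrite !ger0_norm; lra.
rewrite distrC [`|b - a|]distrC [`|a - b|]gtr0_norm ?subr_gt0//.
apply: (has_slope_lipschitz_itv _ (ltW ba) _ H) => //.
move=> t /andP[ta tb]; apply: HM; first by lra.
by rewrite !ler0_norm; lra.
Qed.

End Slopes.

(** * The Young inequality and its optimal parameter *)

Section RealLemmas.
Set Implicit Arguments.
Unset Strict Implicit.
Context {R : realType}.

(** Optimising the Young inequality over its parameter.  The optimal [a = G / F]
    is perturbed by a small [d] so that [F = 0] or [G = 0] needs no separate
    treatment. *)
Lemma le_mul_of_young (x F G : R) : 0 <= F -> 0 <= G ->
  (forall a, 0 < a -> 2 * x <= a * F ^+ 2 + a^-1 * G ^+ 2) -> x <= F * G.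
Proof.
move=> F0 G0 H; apply/ler_addgt0Pr => e e0.
pose d := Num.min 1 (e / (F + G + 1)).
have FG : 0 < F + G + 1 by lra.
have d0 : 0 < d by rewrite lt_min ltr01 divr_gt0.
have d1 : d * (F + G + 1) <= e by rewrite -ler_pdivlMr// ge_min lexx orbT.
have Fd : 0 < F + d by lra.
have Gd : 0 < G + d by lra.
have := H ((G + d) / (F + d)) (divr_gt0 Gd Fd).
have -> : ((G + d) / (F + d))^-1 = (F + d) / (G + d) by field; rewrite !gt_eqF.
have h1 : (G + d) / (F + d) * F ^+ 2 <= (G + d) * F.
  rewrite -mulrA; apply: ler_wpM2l; first exact: ltW.
  by rewrite ler_pdivrMl// expr2; nra.
have h2 : (F + d) / (G + d) * G ^+ 2 <= (F + d) * G.
  rewrite -mulrA; apply: ler_wpM2l; first exact: ltW.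
  by rewrite ler_pdivrMl// expr2; nra.
by nra.
Qed.

Lemma young2 (a x y : R) : 0 < a -> 2 * `|x * y| <= a * x ^+ 2 + a^-1 * y ^+ 2.
Proof.
move=> a0; have ai : 0 < a^-1 by rewrite invr_gt0.
have aa : a * a^-1 = 1 by rewrite divff// gt_eqF.
rewrite -[x ^+ 2]real_normK ?num_real// -[y ^+ 2]real_normK ?num_real// normrM.
set X := `|x|; set Y := `|y|.
rewrite -subr_ge0.
have -> : a * X ^+ 2 + a^-1 * Y ^+ 2 - 2 * (X * Y) = a^-1 * (a * X - Y) ^+ 2.
  by field; rewrite gt_eqF.
by rewrite mulr_ge0 ?sqr_ge0// ltW.
Qed.

End RealLemmas.

(** * Weighted inner products on L^2 *)

Section L2Theory.
Set Implicit Arguments.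
Unset Strict Implicit.
Context {d : measure_display} {X : measurableType d} {R : realType}.
Variable mu : {measure set X -> \bar R}.
Implicit Types (f g h : X -> R[i]) (q : X -> R) (c : R).
Local Notation Re := complex.Re.
Local Notation Im := complex.Im.
Local Notation integr F := (mu.-integrable setT (EFin \o F)).

Lemma ae_le_Rintegral (F G : X -> R) : measurable_fun setT F -> integr G ->
  {ae mu, forall x, `|F x| <= G x} ->
  integr F /\ `|\int[mu]_x F x| <= \int[mu]_x G x.
Proof.
move=> mF iG FG.
have mG : measurable_fun setT G by apply/measurable_EFinP; exact: measurable_int iG.
have mnF : measurable_fun setT (fun x => `|F x|) by exact: measurableT_comp.
have mnG : measurable_fun setT (fun x => `|G x|) by exact: measurableT_comp.
have le1 : (\int[mu]_x (`|F x|)%:E <= \int[mu]_x (`|G x|)%:E)%E.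
  apply: ae_ge0_le_integral => //.
  - exact/measurable_EFinP.
  - exact/measurable_EFinP.
  - apply: filterS FG => x h _.
    by rewrite lee_fin (le_trans h)// ler_norm.
have iF : integr F.
  move/integrableP : (iG) => [_ fin]; apply/integrableP; split.
    exact/measurable_EFinP.
  by apply: le_lt_trans fin.
split=> //.
apply: le_trans (le_normr_Rintegral _ iF) _ => //.
have -> : \int[mu]_x G x = \int[mu]_x `|G x|.
  rewrite /Rintegral; congr fine; apply: ae_eq_integral => //.
  - exact/measurable_EFinP.
  - exact/measurable_EFinP.
  - apply: filterS FG => x h _ /=.
    by rewrite ger0_norm// (le_trans _ h).
rewrite /Rintegral fine_le//.
- exact/integrable_fin_num/integrable_norm.
- exact/integrable_fin_num/integrable_norm.
Qed.

Lemma L2_measurable f : L2 mu f ->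
  measurable_fun setT (fun x => Re (f x)) /\
  measurable_fun setT (fun x => Im (f x)).
Proof. by move=> [/sub_Lfun_mfun + /sub_Lfun_mfun]; rewrite !inE. Qed.

Lemma L2_integrable f : L2 mu f ->
  integr (fun x => Re (f x) ^+ 2 + Im (f x) ^+ 2).
Proof.
move=> [/Lfun2_integrable_sqr fr /Lfun2_integrable_sqr fi].
exact: (@integrableD _ _ _ _ _ measurableT _ _ fr fi).
Qed.

Lemma L2normE f : L2norm mu f ^+ 2 = \int[mu]_x (Re (f x) ^+ 2 + Im (f x) ^+ 2).
Proof.
rewrite sqr_sqrtr//; apply: Rintegral_ge0 => x _.
by rewrite addr_ge0 ?sqr_ge0.
Qed.

Lemma L2norm_ge0 f : 0 <= L2norm mu f. Proof. exact: sqrtr_ge0. Qed.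

(** The Cauchy-Schwarz inequality in the form used for both the real and the
    imaginary part of a weighted inner product: the pointwise Young inequality
    is integrated, then its parameter is optimised. *)
Lemma le_L2_young (F : X -> R) c f g : L2 mu f -> L2 mu g ->
  0 <= c -> measurable_fun setT F ->
  (forall a, 0 < a -> {ae mu, forall x, 2 * `|F x| <=
     c * (a * (Re (f x) ^+ 2 + Im (f x) ^+ 2) +
          a^-1 * (Re (g x) ^+ 2 + Im (g x) ^+ 2))}) ->
  integr F /\ `|\int[mu]_x F x| <= c * (L2norm mu f * L2norm mu g).
Proof.
move=> Lf Lg c0 mF H.
pose Y a x := a * (Re (f x) ^+ 2 + Im (f x) ^+ 2) +
          a^-1 * (Re (g x) ^+ 2 + Im (g x) ^+ 2).
have If a : integr (fun x => a * (Re (f x) ^+ 2 + Im (f x) ^+ 2)).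
  exact: (@integrableZl _ _ _ _ _ measurableT a _ (L2_integrable Lf)).
have Ig a : integr (fun x => a * (Re (g x) ^+ 2 + Im (g x) ^+ 2)).
  exact: (@integrableZl _ _ _ _ _ measurableT a _ (L2_integrable Lg)).
have IY a : integr (Y a).
  exact: (@integrableD _ _ _ _ _ measurableT _ _ (If a) (Ig a^-1)).
have IYc a : integr (fun x => c / 2 * Y a x).
  exact: (@integrableZl _ _ _ _ _ measurableT (c / 2) _ (IY a)).
have E a : \int[mu]_x (c / 2 * Y a x) =
    c / 2 * (a * L2norm mu f ^+ 2 + a^-1 * L2norm mu g ^+ 2).
  rewrite RintegralZl// RintegralD// RintegralZl ?L2_integrable//.
  by rewrite RintegralZl ?L2_integrable// !L2normE.
have K a : 0 < a -> integr F /\ `|\int[mu]_x F x| <= \int[mu]_x (c / 2 * Y a x).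
  move=> a0; apply: ae_le_Rintegral => //.
  by apply: filterS (H a a0) => x; rewrite -/(Y a x); lra.
split; first exact: (K 1 ltr01).1.
have [c00|cn0] := eqVneq c 0.
  by have := (K 1 ltr01).2; rewrite E c00 !mul0r.
have cp : 0 < c by rewrite lt_def cn0.
rewrite mulrC -ler_pdivrMr//; apply: le_mul_of_young; rewrite ?L2norm_ge0//.
move=> a a0; have := (K a a0).2; rewrite E => h.
by rewrite mulrA ler_pdivrMr//; lra.
Qed.

(** The form of multiplication by the potential [q]; the weight [1] gives the
    inner product of L^2, so both are treated by the same lemmas. *)
Definition weighted_inner q f g : R[i] :=
  cintegral mu (fun x => (q x)%:C%C * f x * (g x)^*%C).

Definition ae_bounded q c := [/\ measurable_fun setT q, 0 <= c &
  {ae mu, forall x, `|q x| <= c}].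

Let Rew q f g x := q x * (Re (f x) * Re (g x) + Im (f x) * Im (g x)).
Let Imw q f g x := q x * (Im (f x) * Re (g x) - Re (f x) * Im (g x)).

Lemma weighted_innerE q f g :
  weighted_inner q f g = Complex (\int[mu]_x Rew q f g x) (\int[mu]_x Imw q f g x).
Proof.
rewrite /weighted_inner /cintegral; congr Complex; apply: eq_Rintegral => x _;
  rewrite /Rew /Imw; case: (f x) => a b; case: (g x) => a' b' /=; ring.
Qed.

Lemma weighted_inner_integrable q c f g : ae_bounded q c -> L2 mu f -> L2 mu g ->
  (integr (Rew q f g) /\
   `|\int[mu]_x Rew q f g x| <= c * (L2norm mu f * L2norm mu g)) /\
  (integr (Imw q f g) /\
   `|\int[mu]_x Imw q f g x| <= c * (L2norm mu f * L2norm mu g)).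
Proof.
move=> [mq c0 qc] Lf Lg.
have [mf1 mf2] := L2_measurable Lf; have [mg1 mg2] := L2_measurable Lg.
split; apply: le_L2_young => //.
- apply: measurable_funM => //.
  by apply: measurable_funD; exact: measurable_funM.
- move=> a a0; apply: filterS qc => x qx.
  rewrite normrM mulrCA; apply: ler_pM => //.
  have := young2 (Re (f x)) (Re (g x)) a0.
  have := young2 (Im (f x)) (Im (g x)) a0.
  have := ler_normD (Re (f x) * Re (g x)) (Im (f x) * Im (g x)).
  lra.
- apply: measurable_funM => //.
  by apply: measurable_funB; exact: measurable_funM.
- move=> a a0; apply: filterS qc => x qx.
  rewrite normrM mulrCA; apply: ler_pM => //.
  have := young2 (Re (f x)) (Im (g x)) a0.
  have := young2 (Im (f x)) (Re (g x)) a0.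
  have := ler_normB (Im (f x) * Re (g x)) (Re (f x) * Im (g x)).
  lra.
Qed.

Lemma weighted_inner_le q c f g : ae_bounded q c -> L2 mu f -> L2 mu g ->
  `|Re (weighted_inner q f g)| <= c * (L2norm mu f * L2norm mu g) /\
  `|Im (weighted_inner q f g)| <= c * (L2norm mu f * L2norm mu g).
Proof.
by move=> hq hf hg; rewrite weighted_innerE;
  have [[_ ?] [_ ?]] := weighted_inner_integrable hq hf hg.
Qed.

Lemma weighted_inner_conj q c f g : ae_bounded q c -> L2 mu f -> L2 mu g ->
  weighted_inner q g f = ((weighted_inner q f g)^*)%C.
Proof.
move=> hq hf hg; have [_ [iI _]] := weighted_inner_integrable hq hf hg.
rewrite !weighted_innerE /=; congr Complex.
  by apply: eq_Rintegral => x _; rewrite /Rew; ring.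
rewrite -mulN1r -RintegralZl//.
by apply: eq_Rintegral => x _; rewrite /Imw; ring.
Qed.

Lemma ReB (z w : R[i]) : Re (z - w) = Re z - Re w.
Proof. by case: z => ? ?; case: w. Qed.

Lemma ImB (z w : R[i]) : Im (z - w) = Im z - Im w.
Proof. by case: z => ? ?; case: w. Qed.

Lemma L2B f g : L2 mu f -> L2 mu g -> L2 mu (f \- g).
Proof.
move=> [f1 f2] [g1 g2]; split.
- have -> : (fun x => Re ((f \- g) x)) = (fun x => Re (f x)) - (fun x => Re (g x)).
    by apply/funext => x; exact: ReB.
  by apply: rpredB; rewrite ?lee1n.
- have -> : (fun x => Im ((f \- g) x)) = (fun x => Im (f x)) - (fun x => Im (g x)).
    by apply/funext => x; exact: ImB.
  by apply: rpredB; rewrite ?lee1n.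
Qed.

Lemma weighted_innerBl q c f g h : ae_bounded q c -> L2 mu f -> L2 mu g -> L2 mu h ->
  weighted_inner q (f \- g) h = weighted_inner q f h - weighted_inner q g h.
Proof.
move=> hq hf hg hh.
have [[? _] [? _]] := weighted_inner_integrable hq hf hh.
have [[? _] [? _]] := weighted_inner_integrable hq hg hh.
rewrite !weighted_innerE; apply/eqP; rewrite eq_complex ReB ImB /=.
apply/andP; split; apply/eqP; rewrite -RintegralB//; apply: eq_Rintegral => x _;
  rewrite /Rew /Imw /=; case: (f x) => ? ?; case: (g x) => ? ? /=; ring.
Qed.

Lemma weighted_innerBq q q' c c' f g : ae_bounded q c -> ae_bounded q' c' ->
  L2 mu f -> L2 mu g ->
  weighted_inner (q \- q') f g = weighted_inner q f g - weighted_inner q' f g.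
Proof.
move=> hq hq' hf hg.
have [[? _] [? _]] := weighted_inner_integrable hq hf hg.
have [[? _] [? _]] := weighted_inner_integrable hq' hf hg.
rewrite !weighted_innerE; apply/eqP; rewrite eq_complex ReB ImB /=.
apply/andP; split; apply/eqP; rewrite -RintegralB//; apply: eq_Rintegral => x _;
  rewrite /Rew /Imw /=; ring.
Qed.

Lemma innerE f g : inner mu f g = weighted_inner (cst 1) f g.
Proof.
rewrite /inner /weighted_inner; congr cintegral; apply/funext => x.
by rewrite mul1r.
Qed.

Lemma ae_bounded1 : ae_bounded (cst 1) 1.
Proof. by split => //; apply: nearW => x; rewrite /= normr1. Qed.

Lemma inner_le f g : L2 mu f -> L2 mu g ->
  `|Re (inner mu f g)| <= L2norm mu f * L2norm mu g /\
  `|Im (inner mu f g)| <= L2norm mu f * L2norm mu g.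
Proof.
by move=> hf hg; have := weighted_inner_le ae_bounded1 hf hg; rewrite innerE mul1r.
Qed.

Lemma innerC f g : L2 mu f -> L2 mu g -> inner mu g f = ((inner mu f g)^*)%C.
Proof. by move=> hf hg; rewrite !innerE (weighted_inner_conj ae_bounded1). Qed.

Lemma innerBl f g h : L2 mu f -> L2 mu g -> L2 mu h ->
  inner mu (f \- g) h = inner mu f h - inner mu g h.
Proof. by move=> hf hg hh; rewrite !innerE (weighted_innerBl ae_bounded1). Qed.

Lemma Re_inner_self f : Re (inner mu f f) = L2norm mu f ^+ 2.
Proof.
rewrite innerE weighted_innerE L2normE /=; apply: eq_Rintegral => x _.
by rewrite /Rew mul1r !expr2.
Qed.

Lemma Re_innerC f g : L2 mu f -> L2 mu g ->
  Re (inner mu g f) = Re (inner mu f g).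
Proof. by move=> hf hg; rewrite innerC//; case: inner. Qed.

Lemma L2norm_sqrB f g : L2 mu f -> L2 mu g ->
  L2norm mu (f \- g) ^+ 2 =
  L2norm mu f ^+ 2 + L2norm mu g ^+ 2 - 2 * Re (inner mu f g).
Proof.
move=> hf hg; have hfg := L2B hf hg.
rewrite -Re_inner_self innerBl// ReB.
rewrite (Re_innerC hfg hf) (Re_innerC hfg hg).
rewrite (innerBl hf hg hf) (innerBl hf hg hg) !ReB !Re_inner_self.
by rewrite (Re_innerC hf hg); ring.
Qed.

Lemma L2norm_le_add_sub f g : L2 mu f -> L2 mu g ->
  L2norm mu f <= L2norm mu (f \- g) + L2norm mu g.
Proof.
move=> hf hg; have hfg := L2B hf hg.
have h0 : forall x, 0 <= L2norm mu x by exact: L2norm_ge0.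
rewrite -(@ler_pXn2r _ 2)// ?nnegrE ?addr_ge0//.
have [+ _] := inner_le hfg hg.
rewrite (innerBl hf hg hg) ReB Re_inner_self ler_norml => /andP[_].
rewrite sqrrD (L2norm_sqrB hf hg).
move: (L2norm mu f) (L2norm mu g) (L2norm mu (f \- g)) (Re _) => a b c r.
by lra.
Qed.


Lemma ae_eq_L2norm f g : L2 mu f -> L2 mu g -> aeq mu f g ->
  L2norm mu f = L2norm mu g.
Proof.
move=> /L2_measurable[? ?] /L2_measurable[? ?] fg; rewrite /L2norm /Rintegral.
congr (Num.sqrt (fine _)); apply: ae_eq_integral => //.
- by apply/measurable_EFinP; apply: measurable_funD; exact: measurable_funX.
- by apply/measurable_EFinP; apply: measurable_funD; exact: measurable_funX.
- by apply: filterS fg => x -> .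
Qed.

End L2Theory.

(** * Energy estimates for form solutions *)

Section Energy.
Set Implicit Arguments.
Unset Strict Implicit.
Context {d : measure_display} {X : measurableType d} {R : realType}.
Variable mu : {measure set X -> \bar R}.
Local Notation Re := complex.Re.
Local Notation Im := complex.Im.

(** What the energy estimates need from the operator.  The second inequality
    replaces additivity of [op_act A] almost everywhere: it follows from
    additivity, and it can be read off directly on the spectral side. *)
Definition form_operator (A : @operator _ X R) : Prop :=
  (forall f, op_dom A f -> L2 mu f /\ L2 mu (op_act A f)) /\
  (forall f g, op_dom A f -> op_dom A g -> op_dom A (f \- g) /\
     L2norm mu (op_act A f) <=
       L2norm mu (op_act A (f \- g)) + L2norm mu (op_act A g)).

Variables (A : @operator _ X R) (T : R).
Hypothesis hA : form_operator A.
Local Notation gn := (graph_norm mu A).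

Section OneSolution.
Variables (p : X -> R) (c : R) (v : X -> R[i]) (u : R -> X -> R[i]).
Hypothesis hp : ae_bounded mu p c.
Hypothesis hu : form_solution mu A T p v u.

Lemma solution_dom t : 0 <= t <= T -> op_dom A (u t).
Proof. by case: hu => h _ _ _; exact: h. Qed.

Lemma solution_L2 t : 0 <= t <= T -> L2 mu (u t).
Proof. by move=> /solution_dom /(proj1 hA)[]. Qed.

(** The equation gives [g = i S], where [S] is the sum of the two forms, so
    the real part of the derivative is minus the imaginary part of [S]. *)
Lemma solution_slope phi t : op_dom A phi -> 0 <= t <= T ->
  has_slope T (fun r => Re (inner mu (u r) phi)) t
    (- (Im (inner mu (op_act A (u t)) (op_act A phi)) +
        Im (weighted_inner mu p (u t) phi))).
Proof.
move=> hphi tT; have [_ _ _ /(_ _ hphi) [g [_ /(_ t tT) [hg eg]]]] := hu.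
have -> : - (Im (inner mu (op_act A (u t)) (op_act A phi)) +
             Im (weighted_inner mu p (u t) phi)) = Re (g t).
  move: eg; rewrite -/(weighted_inner mu p (u t) phi).
  case: (inner _ _ _) => a b; case: (weighted_inner _ _ _ _) => a' b'; case: (g t) => x y.
  by move/(congr1 (fun z : R[i] => Im z)) => /=; lra.
exact: deriv_within_slope_Re.
Qed.

Lemma graph_norm_ge0 f : 0 <= gn f.
Proof. by rewrite addr_ge0 ?L2norm_ge0. Qed.

Lemma solution_close t : 0 <= t <= T -> forall e, 0 < e ->
  exists2 d, 0 < d & forall r, 0 <= r <= T -> `|r - t| < d ->
    gn (u r \- u t) <= e.
Proof.
move=> tT e e0; have [_ /(_ t tT) /cvgrPdist_le /(_ e e0) H _ _] := hu.
move: H; rewrite near_withinE => -[k /= k0 Hk]; exists k => // r rT rt.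
have := Hk r; rewrite /ball/= distrC => /(_ rt); rewrite in_itv/= => /(_ rT).
by rewrite sub0r normrN ger0_norm// graph_norm_ge0.
Qed.

Lemma slope_le f phi : op_dom A f -> op_dom A phi ->
  `|- (Im (inner mu (op_act A f) (op_act A phi)) + Im (weighted_inner mu p f phi))|
  <= (1 + c) * (gn f * gn phi).
Proof.
move=> df dphi; have [lf laf] := hA.1 _ df; have [lp lap] := hA.1 _ dphi.
have [_ h1] := inner_le laf lap; have [_ h2] := weighted_inner_le hp lf lp.
rewrite normrN (le_trans (ler_normD _ _))//.
have [_ c0 _] := hp.
have := L2norm_ge0 mu f; have := L2norm_ge0 mu phi.
have := L2norm_ge0 mu (op_act A f); have := L2norm_ge0 mu (op_act A phi).
move: h1 h2; rewrite /graph_norm.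
set a := L2norm _ _; set b := L2norm _ _; set a' := L2norm _ _; set b' := L2norm _ _.
move=> h1 h2 p1 p2 p3 p4.
rewrite mulrDl mul1r; apply: lerD; [apply: le_trans h1 _|apply: le_trans h2 _].
  by apply: ler_pM => //; lra.
by apply: ler_wpM2l => //; apply: ler_pM => //; lra.
Qed.

(** The norm of [u r] can be differentiated although [u] is differentiable only
    against fixed vectors of the form domain.  Test the equation with the
    increment [phi = u r - u t] itself: by the mean value theorem the square of
    its L^2 norm is at most [M * |r - t|] times the graph norm of [phi], and
    this graph norm tends to [0] because [u] is continuous with values in the
    form domain. *)
Lemma solution_increment t : 0 <= t <= T -> forall e, 0 < e ->
  exists2 d, 0 < d & forall r, 0 <= r <= T -> `|r - t| < d ->
    L2norm mu (u r \- u t) ^+ 2 <= e * `|r - t|.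
Proof.
move=> tT e e0; have [d1 d10 H1] := solution_close tT ltr01.
have [_ c0 _] := hp.
pose M := (1 + c) * (1 + gn (u t)).
have M0 : 0 < M by rewrite mulr_gt0//; have := graph_norm_ge0 (u t); lra.
have [d2 d20 H2] := solution_close tT (divr_gt0 e0 M0).
exists (Num.min d1 d2); first by rewrite lt_min d10.
move=> r rT; rewrite lt_min => /andP[r1 r2].
have [dr dt] := (solution_dom rT, solution_dom tT).
have [lr lt] := (solution_L2 rT, solution_L2 tT).
have [dphi _] := hA.2 _ _ dr dt.
set phi := u r \- u t in dphi *.
have lphi := (hA.1 _ dphi).1.
have E : L2norm mu phi ^+ 2 = Re (inner mu (u r) phi) - Re (inner mu (u t) phi).
  by rewrite -Re_inner_self {1}/phi innerBl// ReB.
have Mphi : M * gn phi <= e by rewrite mulrC -ler_pdivlMr//; exact: H2.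
rewrite E (le_trans (ler_norm _))//.
apply: le_trans (ler_wpM2r (normr_ge0 _) Mphi).
apply: (has_slope_lipschitz (F := fun r => Re (inner mu (u r) phi)) tT rT
  (fun s sT => solution_slope dphi sT)) => s sT sr.
have ds := solution_dom sT.
apply: le_trans (slope_le ds dphi) _.
(* The graph norm of [u s] is at most [1 + gn (u t)], as [s] is near [t]. *)
rewrite mulrA; apply: ler_wpM2r; first exact: graph_norm_ge0.
apply: ler_wpM2l; first by lra.
have := H1 s sT (le_lt_trans sr r1).
have [_] := hA.2 _ _ ds dt.
have := L2norm_le_add_sub (solution_L2 sT) lt.
rewrite /graph_norm; lra.
Qed.

End OneSolution.

Section TwoSolutions.
Variables (p p' : X -> R) (c c' : R) (v v' : X -> R[i]) (u u' : R -> X -> R[i]).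
Hypotheses (hp : ae_bounded mu p c) (hp' : ae_bounded mu p' c').
Hypotheses (hu : form_solution mu A T p v u) (hu' : form_solution mu A T p' v' u').

(** In the product rule for [inner (u r) (u' r)] the second-order term is
    negligible by [solution_increment].  The two contributions of [A] are
    conjugate to each other and their imaginary parts cancel, so that only the
    difference of the potentials remains. *)
Lemma pair_slope t : 0 <= t <= T ->
  has_slope T (fun r => Re (inner mu (u r) (u' r))) t
    (- Im (weighted_inner mu (p \- p') (u t) (u' t))).
Proof.
move=> tT e e0.
have [lt lt'] := (solution_L2 hu tT, solution_L2 hu' tT).
have [dt dt'] := (solution_dom hu tT, solution_dom hu' tT).
have e4 : 0 < e / 4 by lra.
have [d1 d10 H1] := solution_slope hu dt' tT e4.
have [d2 d20 H2] := solution_slope hu' dt tT e4.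
have [d3 d30 H3] := solution_increment hp hu tT e4.
have [d4 d40 H4] := solution_increment hp' hu' tT e4.
exists (Num.min (Num.min d1 d2) (Num.min d3 d4)).
  by rewrite !lt_min d10 d20 d30.
move=> r rT; rewrite !lt_min => /andP[/andP[r1 r2] /andP[r3 r4]].
have [lr lr'] := (solution_L2 hu rT, solution_L2 hu' rT).
have := H1 r rT r1; have := H2 r rT r2; have := H3 r rT r3; have := H4 r rT r4.
have [] := inner_le (L2B lr lt) (L2B lr' lt') => + _.
(* The increment of [Re (inner (u r) (u' r))] is the sum of the increments of
   its two factors taken separately and of this second-order term. *)
have -> : Re (inner mu (u r \- u t) (u' r \- u' t)) =
   Re (inner mu (u r) (u' r)) - Re (inner mu (u r) (u' t)) -
   Re (inner mu (u' r) (u t)) + Re (inner mu (u t) (u' t)).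
  rewrite innerBl//; last exact: L2B.
  rewrite ReB (Re_innerC (L2B lr' lt') lr) (Re_innerC (L2B lr' lt') lt).
  rewrite !innerBl// !ReB (Re_innerC lr lr') (Re_innerC lr lt').
  by rewrite (Re_innerC lt lt'); ring.
have -> : Re (inner mu (u' t) (u t)) = Re (inner mu (u t) (u' t)).
  exact: Re_innerC.
have -> : Im (inner mu (op_act A (u' t)) (op_act A (u t))) =
   - Im (inner mu (op_act A (u t)) (op_act A (u' t))).
  by rewrite (innerC (hA.1 _ dt).2 (hA.1 _ dt').2); case: inner.
have -> : Im (weighted_inner mu p' (u' t) (u t)) =
   - Im (weighted_inner mu p' (u t) (u' t)).
  by rewrite (weighted_inner_conj hp' lt lt'); case: weighted_inner.
rewrite (weighted_innerBq hp hp' lt lt') ImB.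
have := L2norm_ge0 mu (u r \- u t); have := L2norm_ge0 mu (u' r \- u' t).
set n := L2norm _ _; set n' := L2norm _ _ => n0 n0'.
have nn : n * n' <= (n ^+ 2 + n' ^+ 2) / 2.
  by have := sqr_ge0 (n - n'); rewrite sqrrB; lra.
move=> h5 h4 h3 h2 h1.
move: h5 h2 h1; rewrite !ler_norml.
move=> /andP[? ?] /andP[? ?] /andP[? ?]; apply/andP; split; lra.
Qed.

End TwoSolutions.

(** Conservation of mass: [pair_slope] for the solution paired with itself has
    the weight [p - p]. *)
Lemma solution_norm p c v u t : ae_bounded mu p c -> L2 mu v ->
  form_solution mu A T p v u -> 0 <= t <= T -> L2norm mu (u t) = L2norm mu v.
Proof.
move=> hp lv hu tT.
have /andP[t0 t1] := tT; have T0 : 0 <= (0 : R) <= T by rewrite lexx (le_trans t0).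
have [_ _ u0v _] := hu.
rewrite -(ae_eq_L2norm (solution_L2 hu T0) lv u0v).
apply/eqP; rewrite -(@eqrXn2 _ 2) ?L2norm_ge0// -subr_eq0 -normr_le0.
rewrite -!Re_inner_self.
rewrite -[leRHS](mul0r `|t - 0|).
apply: (has_slope_lipschitz T0 tT (pair_slope hp hp hu hu)) => s sT _.
have ls := solution_L2 hu sT.
by rewrite (weighted_innerBq hp hp ls ls) subrr /= oppr0 normr0.
Qed.

(** Expand the square of the norm of the difference.  The two square norms are
    conserved, and the real part of the inner product moves with speed at most
    [e] times the product of the conserved norms. *)
Lemma solution_stability p p' c c' e v v' u u' t :
  ae_bounded mu p c -> ae_bounded mu p' c' -> ae_bounded mu (p \- p') e ->
  L2 mu v -> L2 mu v' ->
  form_solution mu A T p v u -> form_solution mu A T p' v' u' ->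
  0 <= t <= T ->
  L2norm mu (u t \- u' t) ^+ 2 <=
  L2norm mu (v \- v') ^+ 2 + 2 * T * e * (L2norm mu v * L2norm mu v').
Proof.
move=> hp hp' hpp lv lv' hu hu' tT.
have /andP[t0 t1] := tT; have T0 : 0 <= (0 : R) <= T by rewrite lexx (le_trans t0).
have [_ _ u0v _] := hu; have [_ _ u0v' _] := hu'.
have [l0 l0'] := (solution_L2 hu T0, solution_L2 hu' T0).
have [lt lt'] := (solution_L2 hu tT, solution_L2 hu' tT).
have -> : L2norm mu (v \- v') = L2norm mu (u 0 \- u' 0).
  apply/esym/ae_eq_L2norm; [exact: L2B|exact: L2B|].
  by apply: filterS2 u0v u0v' => x /= -> ->.
rewrite (L2norm_sqrB lt lt') (L2norm_sqrB l0 l0').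
rewrite !(solution_norm hp lv hu)// !(solution_norm hp' lv' hu')//.
have : `|Re (inner mu (u t) (u' t)) - Re (inner mu (u 0) (u' 0))| <=
    e * (L2norm mu v * L2norm mu v') * `|t - 0|.
  apply: (has_slope_lipschitz T0 tT (pair_slope hp hp' hu hu')) => s sT _.
  have [ls ls'] := (solution_L2 hu sT, solution_L2 hu' sT).
  rewrite normrN -(solution_norm hp lv hu sT) -(solution_norm hp' lv' hu' sT).
  exact: (weighted_inner_le hpp ls ls').2.
have [_ e0 _] := hpp.
rewrite subr0 (ger0_norm t0).
have K0 : 0 <= e * (L2norm mu v * L2norm mu v').
  by rewrite !mulr_ge0 ?L2norm_ge0.
have := ler_wpM2l K0 t1.
rewrite ler_norml => h /andP[? _]; lra.
Qed.

End Energy.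

(** * Operators given by a spectral representation; bounded potentials *)

Section MultiplicationOperator.
Set Implicit Arguments.
Unset Strict Implicit.
Context {R : realType}.
Local Notation Re := complex.Re.
Local Notation Im := complex.Im.

Lemma Lfun2_sqr {d} {X : measurableType d} (mu : {measure set X -> \bar R}) (F : X -> R) :
  measurable_fun setT F -> mu.-integrable setT (EFin \o (fun x => F x ^+ 2)) ->
  F \in Lfun mu 2%:E.
Proof.
move=> mF /integrableP[_ fin]; rewrite inE; apply/andP; split; rewrite !inE//=.
rewrite /finite_norm unlock; apply: poweR_lty.
apply: le_lt_trans fin; rewrite le_eqVlt; apply/orP; left; apply/eqP.
apply: eq_integral => x _ /=.
by rewrite powR_mulrn// normrX.
Qed.

Lemma L2_aeq {d} {X : measurableType d}
    (mu : {measure set X -> \bar R}) (f g : X -> R[i]) :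
  L2 mu f -> aeq mu f g ->
  measurable_fun setT (fun x => Re (g x)) ->
  measurable_fun setT (fun x => Im (g x)) -> L2 mu g.
Proof.
move=> Lf fg m1 m2; have := L2_integrable Lf => If.
have H (F : X -> R) : measurable_fun setT F ->
  {ae mu, forall x, F x ^+ 2 <= Re (f x) ^+ 2 + Im (f x) ^+ 2} ->
  F \in Lfun mu 2%:E.
  move=> mF FH; apply: Lfun2_sqr => //.
  apply: (ae_le_Rintegral (G := fun x => Re (f x) ^+ 2 + Im (f x) ^+ 2) _ If _).1.
    exact: measurable_funX.
  by apply: filterS FH => x; rewrite ger0_norm ?sqr_ge0.
split; apply: H => //; apply: filterS fg => x ->.
  by rewrite lerDl sqr_ge0.
by rewrite lerDr sqr_ge0.
Qed.

Lemma unitary_L2norm {d d'} {X : measurableType d} {Y : measurableType d'}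
    (mu : {measure set X -> \bar R}) (m : {measure set Y -> \bar R})
    (U : (X -> R[i]) -> Y -> R[i]) f :
  unitary_map mu m U -> L2 mu f -> L2norm m (U f) = L2norm mu f.
Proof.
move=> [_ _ H _] Lf; apply/eqP; rewrite -(@eqrXn2 _ 2) ?L2norm_ge0//.
by rewrite -!Re_inner_self H.
Qed.

(** The unitary [U] carries [A] to multiplication by [sigma], which is linear
    almost everywhere because [U] is.  Since [U] preserves norms, both
    properties are checked after applying it.  The measurability of
    [sigma * U (f - g)] comes from [f - g] lying in L^2 and not from the almost
    everywhere equality, as the measure need not be complete. *)
Lemma diagonalizes_form_operator {d d'} {X : measurableType d} {Y : measurableType d'}
    (mu : {measure set X -> \bar R}) (m : {measure set Y -> \bar R})
    (U : (X -> R[i]) -> Y -> R[i]) (sigma : Y -> R) (A : @operator _ X R) :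
  measurable_fun setT sigma -> diagonalizes mu m U sigma A -> form_operator mu A.
Proof.
move=> ms [hU hdom hact].
have LA f : op_dom A f -> L2 mu f /\ L2 mu (op_act A f).
  by move=> df; split; [exact: ((hdom f).1 df).1|exact: (hact f df).1].
split=> // f g df dg.
have [UL2 Ulin _ _] := hU.
have [[Lf LAf] [Lg LAg]] := (LA _ df, LA _ dg).
pose mult f y : R[i] := (sigma y)%:C%C * U f y.
have [[_ Lmf] [_ Lmg]] := ((hdom f).1 df, (hdom g).1 dg).
have Lfg := L2B Lf Lg.
have ae : aeq m (mult f \- mult g) (mult (f \- g)).
  have E : f \- g = (fun x => -1 * g x + f x).
    by apply/funext => x /=; rewrite mulN1r addrC.
  have := Ulin (-1) g f Lg Lf; rewrite -E; apply: filterS => y Uy.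
  by rewrite /mult Uy /= mulrDr mulN1r mulrN addrC.
have [mU1 mU2] := L2_measurable (UL2 _ Lfg).
have Lmfg : L2 m (mult (f \- g)).
  apply: L2_aeq (L2B Lmf Lmg) ae _ _.
    rewrite [X in measurable_fun _ X](_ : _ = (fun y => sigma y * Re (U (f \- g) y))).
      exact: measurable_funM.
    by apply/funext => y; rewrite /mult; case: (U _ y) => a b /=; ring.
  rewrite [X in measurable_fun _ X](_ : _ = (fun y => sigma y * Im (U (f \- g) y))).
    exact: measurable_funM.
  by apply/funext => y; rewrite /mult; case: (U _ y) => a b /=; ring.
have dfg : op_dom A (f \- g) by apply/hdom.
split=> //.
have N h : op_dom A h -> L2 m (mult h) -> L2norm mu (op_act A h) = L2norm m (mult h).
  move=> dh Lmh; rewrite -(unitary_L2norm hU (LA _ dh).2).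
  by apply: ae_eq_L2norm => //; [exact/UL2/(LA _ dh).2|exact: (hact _ dh).2].
rewrite !N// -(ae_eq_L2norm (L2B Lmf Lmg) Lmfg ae).
exact: L2norm_le_add_sub.
Qed.

Lemma real_power_form_operator {d} {X : measurableType d}
    (mu : {measure set X -> \bar R}) (B A : @operator _ X R) (a : R) :
  real_power mu B a A -> form_operator mu A.
Proof.
move=> [d' [Y [m [U [sigma [ms _ _ hA]]]]]].
apply: diagonalizes_form_operator hA.
exact: (measurableT_comp (measurable_powR _) ms).
Qed.

Lemma Linf_ae_bounded {d} {X : measurableType d}
    (mu : {measure set X -> \bar R}) (p : X -> R) :
  (0 < mu setT)%E -> Linf mu p -> ae_bounded mu p (Linf_norm mu p).
Proof.
move=> mu0; rewrite /Linf /= inE => /andP[]; rewrite !inE/= => mp fin.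
have N0 := Lnorm_ge0 mu +oo%E (EFin \o p).
split=> //; first exact: fine_ge0.
have : {ae mu, forall x, (`|(p x)%:E| <= 'N[mu]_+oo [EFin \o p])%E}.
  by rewrite unlock mu0; exact: ess_sup_ge.
apply: filterS => x h; rewrite -lee_fin /Linf_norm fineK//.
by rewrite ge0_fin_numE.
Qed.

Lemma LinfB {d} {X : measurableType d}
    (mu : {measure set X -> \bar R}) (p p' : X -> R) :
  Linf mu p -> Linf mu p' -> Linf mu (p \- p').
Proof. by move=> hp hp'; apply: rpredB => //; rewrite leey. Qed.

(** The essential supremum norm is [0] by convention when the whole space is
    null, so it dominates the function only on a space of positive measure. *)
Lemma haar_measure_setT {n : nat} (G : graded_group R n)
    (mu : {measure set (borelV R n) -> \bar R}) : haar_measure G mu ->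
  (0 < mu setT)%E.
Proof. by move=> [_ _ h]; apply: h; [exact: openT|exists 0]. Qed.

End MultiplicationOperator.

(** * Uniqueness of the very weak solution *)

Theorem theorem3p10 (R : realType) (n : nat) (G : graded_group R n)
    (mu : {measure set (borelV R n) -> \bar R}) (hmu : haar_measure G mu)
    (nu : R) (hnu : 0 < nu)
    (P : lidiff_op R n) (hP : positive_rockland G mu P nu)
    (B : @operator _ (borelV R n) R) (hB : sa_extension G mu P B)
    (s T : R) (hs : 0 < s) (hT : 0 < T)
    (* A = B^(s/2), with domain H^(s nu / 2) *)
    (A : @operator _ (borelV R n) R) (hA : real_power mu B (s / 2) A)
    (u0 : ('rV[R]_n -> R[i]) -> R[i]) (hu0 : distribution_on u0)
    (hu0' : (exists2 f, op_dom A f & represents mu f u0)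
            \/ compactly_supported u0)
    (p p' : R -> borelV R n -> R)
    (hp : moderate (Linf mu) (Linf_norm mu) p)
    (hp' : moderate (Linf mu) (Linf_norm mu) p')
    (hp0 : forall e, 0 < e <= 1 -> {ae mu, forall x, 0 <= p e x})
    (hp'0 : forall e, 0 < e <= 1 -> {ae mu, forall x, 0 <= p' e x})
    (hpp' : negligible_net (Linf_norm mu) (fun e => p e \- p' e))
    (v v' : R -> borelV R n -> R[i])
    (hv : regularisation G mu u0 v) (hv' : regularisation G mu u0 v')
    (hvm : moderate (op_dom A) (graph_norm mu A) v)
    (hv'm : moderate (op_dom A) (graph_norm mu A) v')
    (hvv' : negligible_net (graph_norm mu A) (fun e => v e \- v' e))
    (u u' : R -> R -> borelV R n -> R[i])
    (hu : forall e, 0 < e <= 1 -> form_solution mu A T (p e) (v e) (u e))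
    (hu' : forall e, 0 < e <= 1 ->
       form_solution mu A T (p' e) (v' e) (u' e)) :
  forall N : nat, exists C : R, 0 < C /\
    forall t e, 0 <= t <= T -> 0 < e <= 1 ->
      L2norm mu (u e t \- u' e t) <= C * e ^+ N.
Proof.
move=> N.
have fA := real_power_form_operator hA.
have mu0 := haar_measure_setT hmu.
have [pL _] := hp; have [p'L _] := hp'.
have [vL [k [K [K0 vK]]]] := hvm; have [v'L [k' [K' [K'0 v'K]]]] := hv'm.
have [Cv [Cv0 vC]] := hvv' N.
(* The order of smallness asked of [p - p'] absorbs the growth [e^-(k + k')]
   of the product of the initial norms, and the estimate is on squares. *)
have [Cp [Cp0 pC]] := hpp' (N + N + (k + k'))%N.
pose D := 2 * T * Cp * (K * K').
have D0 : 0 < D by rewrite !mulr_gt0.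
exists (Cv + D + 1); split; first by rewrite !addr_gt0.
move=> t e tT e01.
have [Lv _] := fA.1 _ (vL e e01); have [Lv' _] := fA.1 _ (v'L e e01).
have hpe := Linf_ae_bounded mu0 (pL e e01).
have hpe' := Linf_ae_bounded mu0 (p'L e e01).
have hppe := Linf_ae_bounded mu0 (LinfB (pL e e01) (p'L e e01)).
have := solution_stability fA hpe hpe' hppe Lv Lv' (hu e e01) (hu' e e01) tT.
have gnle f : L2norm mu f <= graph_norm mu A f by rewrite lerDr L2norm_ge0.
have := le_trans (gnle _) (vC e e01).
have := le_trans (gnle _) (vK e e01); have := le_trans (gnle _) (v'K e e01).
have := pC e e01.
have := L2norm_ge0 mu (v e); have := L2norm_ge0 mu (v' e).
have := L2norm_ge0 mu (v e \- v' e); have := L2norm_ge0 mu (u e t \- u' e t).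
have [_ + _] := hppe.
set W := L2norm _ (u e t \- _); set V := L2norm _ (v e \- _).
set a := L2norm _ (v e); set a' := L2norm _ (v' e); set q := Linf_norm _ _.
move=> q0 W0 V0 a'0 a0 qC a'K aK VC H.
have e0 : 0 < e by case/andP: e01.
set z := e ^+ N in VC *.
have z0 : 0 <= z by rewrite exprn_ge0// ltW.
have qaa : q * (a * a') <= Cp * (K * K') * z ^+ 2.
  apply: le_trans (ler_pM q0 (mulr_ge0 a0 a'0) qC (ler_pM a0 a'0 aK a'K)) _.
  rewrite le_eqVlt; apply/orP; left; apply/eqP.
  rewrite !exprD -/z; field.
  by rewrite !expf_neq0 ?gt_eqF.
have H2 : W ^+ 2 <= (Cv ^+ 2 + D) * z ^+ 2.
  have VV : V ^+ 2 <= (Cv * z) ^+ 2.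
    by rewrite ler_pXn2r// nnegrE mulr_ge0// ltW.
  have T2 : 0 <= 2 * T by rewrite mulr_ge0// ltW.
  have := ler_wpM2l T2 qaa; move: H VV; rewrite /D exprMn; lra.
rewrite -(@ler_pXn2r _ 2)// ?nnegrE ?mulr_ge0//; last lra.
apply: le_trans H2 _; rewrite exprMn ler_wpM2r ?sqr_ge0//.
by nra.
Qed.
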